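(* Let $G$ and $H$ be connected graphs of orders $n$ and $n'$, respectively. Suppose $G$ and $H$ have $t$ and $t'$ true twin equivalence classes, respectively, and $n_1$ and $n_1'$ vertices, respectively, not belonging to any true twin equivalence class. Then $$\operatorname{dim}(G\boxtimes H)\ge nn'-n_1t'-n_1't-tt'-n_1n_1'.$$ Moreover, if $V(G)$ is partitioned into $t$ true twin equivalence classes, then $$\operatorname{dim}_A(G\boxtimes H)=\operatorname{dim}(G\boxtimes H)=nn'-n_1't-tt'.$$
   Context: All graphs are finite, simple, undirected. The twin equivalence relation on $V(G)$ is: $x\,\mathcal R\,y$ iff $N_G[x]=N_G[y]$ or $N_G(x)=N_G(y)$. A true twin equivalence class is a twin equivalence class $U$ with $|U|>1$ and $N_G[x]=N_G[y]$ for all $x,y\in U$. The strong product $G\boxtimes H$ has vertex set $V(G)\times V(H)$, with distinct $(x_1,x_2),(y_1,y_2)$ adjacent iff $x_1\in N_G[y_1]$ and $x_2\in N_H[y_2]$. For connected graphs with shortest-path distance $d$, $\operatorname{dim}$ is the minimum size of a vertex set $S$ such that every two distinct vertices $x,y$ satisfy $d(s,x)\ne d(s,y)$ for some $s\in S$; $\operatorname{dim}_A$ is the minimum size of a set $S$ such that for every two distinct vertices $x,y\notin S$ some $s\in S$ satisfies $|N(s)\cap\{x,y\}|=1$. *)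

(* Defs.v *)
From mathcomp Require Import all_boot.

Set Implicit Arguments.
Unset Strict Implicit.
Unset Printing Implicit Defensive.

Record sgraph := SGraph {
  vertex :> finType;
  adj : rel vertex;
  adj_sym : symmetric adj;
  adj_irrefl : irreflexive adj }.

Section Graph.
Variable G : sgraph.
Implicit Types (x y : G) (S U : {set G}).

Definition connected : Prop :=
  0 < #|G| /\ forall x y, connect (@adj G) x y.

Definition open_nbhd x : {set G} := [set y | adj x y].
Definition closed_nbhd x : {set G} := x |: open_nbhd x.

Lemma in_closed_nbhdC x y : (x \in closed_nbhd y) = (y \in closed_nbhd x).
Proof. by rewrite !inE eq_sym adj_sym. Qed.

Definition twin : rel G := fun x y =>
  (closed_nbhd x == closed_nbhd y) || (open_nbhd x == open_nbhd y).

Definition twin_classes : {set {set G}} :=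
  equivalence_partition twin [set: G].

Definition true_twin_classes : {set {set G}} :=
  [set U in twin_classes | (1 < #|U|) &&
     [forall x in U, forall y in U, closed_nbhd x == closed_nbhd y]].

Definition has_path_of_length x y (k : nat) : bool :=
  [exists p : k.-tuple G,
     [&& path (@adj G) x p, uniq (x :: p) & last x p == y]].

(* [find] on [iota 0 #|G|] returns the least length itself; vertices in
   different components get the dummy value #|G|, which exceeds the length
   of every path. *)
Definition dist x y : nat := find (has_path_of_length x y) (iota 0 #|G|).

Definition resolving S : bool :=
  [forall x, forall y, (x != y) ==> [exists s in S, dist s x != dist s y]].

Definition adjacency_resolving S : bool :=
  [forall x, forall y, [&& x != y, x \notin S & y \notin S] ==>
     [exists s in S, #|open_nbhd s :&: [set x; y]| == 1]].

(* In both minima the default candidate [set: G] is feasible; see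
   [resolving_setT] and [adjacency_resolving_setT]. *)
Definition metric_dim : nat := #|[arg min_(S < [set: G] | resolving S) #|S|]|.
Definition adjacency_dim : nat :=
  #|[arg min_(S < [set: G] | adjacency_resolving S) #|S|]|.

Lemma has_path0 x y : has_path_of_length x y 0 = (x == y).
Proof.
apply/existsP/eqP => [[p]|->]; last by exists [tuple]; rewrite /= eqxx.
by rewrite (tuple0 p) /= => /eqP.
Qed.

Lemma dist_eq0 x y : (dist x y == 0) = (x == y).
Proof.
rewrite /dist; have : 0 < #|G| by apply/card_gt0P; exists x.
by case: #|G| => // n _; rewrite /= has_path0; case: (x == y).
Qed.

Lemma resolving_setT : resolving [set: G].
Proof.
apply/forallP => x; apply/forallP => y; apply/implyP => xy.
apply/existsP; exists x; rewrite inE /= (eqP (_ : dist x x == 0)) ?dist_eq0 //.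
by rewrite eq_sym dist_eq0.
Qed.

Lemma adjacency_resolving_setT : adjacency_resolving [set: G].
Proof.
by apply/forallP => x; apply/forallP => y; rewrite !inE /= andbF.
Qed.

End Graph.

Section StrongProduct.
Variables G H : sgraph.

Definition strong_adj : rel (G * H) := fun x y =>
  [&& x != y, x.1 \in closed_nbhd y.1 & x.2 \in closed_nbhd y.2].

Lemma strong_adj_sym : symmetric strong_adj.
Proof.
by move=> x y; rewrite /strong_adj eq_sym (in_closed_nbhdC x.1)
  (in_closed_nbhdC x.2).
Qed.

Lemma strong_adj_irrefl : irreflexive strong_adj.
Proof. by move=> x; rewrite /strong_adj eqxx. Qed.

Definition strong_product : sgraph :=
  SGraph strong_adj_sym strong_adj_irrefl.

End StrongProduct.

(* Main.v *)
(* Write c(K) for the number of distinct closed neighbourhoods of K. Swapping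
   two vertices with the same closed neighbourhood is an automorphism, so no
   third vertex resolves them: a resolving set of K omits at most one vertex per
   closed neighbourhood and has at least |K| - c(K) elements. If every vertex
   has a true twin, the complement of a transversal attains this bound and is
   even adjacency resolving. Closed neighbourhoods in the strong product are
   products of closed neighbourhoods, so c is multiplicative, and c(G) = t + n1. *)
Require Import Defs.
From HB Require Import structures.
From mathcomp Require Import all_boot all_order all_algebra.
From mathcomp Require Import perm zify.

Set Implicit Arguments.
Unset Strict Implicit.
Unset Printing Implicit Defensive.

(** * True twins and the lower bound for resolving sets *)

Section TrueTwins.
Variable G : sgraph.
Implicit Types (x y z s : G) (S A : {set G}).

Definition closed_nbhds : {set {set G}} := [set closed_nbhd x | x : G].

(** A description of the union of the true twin classes through closed neighbourhoods only; see
    [cover_true_twin_classes]. *)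
Definition nontrivial_class : {set G} :=
  [set x | [exists y, (y != x) && (closed_nbhd y == closed_nbhd x)]].

Lemma mem_closed_nbhd x : x \in closed_nbhd x.
Proof. by rewrite !inE eqxx. Qed.

Lemma adj_closed_nbhd x y : adj x y = (y != x) && (y \in closed_nbhd x).
Proof. by rewrite !inE; case: eqP => [->|_] //=; rewrite adj_irrefl. Qed.

Lemma closed_nbhd_eq_mem x y z :
  closed_nbhd x = closed_nbhd y -> (x \in closed_nbhd z) = (y \in closed_nbhd z).
Proof. by move=> e; rewrite in_closed_nbhdC e in_closed_nbhdC. Qed.

Lemma adj_tperm x y (u v : G) : closed_nbhd x = closed_nbhd y ->
  adj (tperm x y u) (tperm x y v) = adj u v.
Proof.
move=> e; rewrite !adj_closed_nbhd (inj_eq perm_inj); congr (_ && _).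
(* The swap moves a vertex only within its fibre of [closed_nbhd], so each side of a membership can
   be replaced separately. *)
have cn w : closed_nbhd (tperm x y w) = closed_nbhd w by case: tpermP => // ->.
by rewrite cn (closed_nbhd_eq_mem _ (cn v)).
Qed.

Lemma has_path_tperm x y s z k : closed_nbhd x = closed_nbhd y ->
  has_path_of_length s z k ->
  has_path_of_length (tperm x y s) (tperm x y z) k.
Proof.
move=> e /existsP[p /and3P[pp up /eqP lp]].
apply/existsP; exists [tuple of map (tperm x y) p].
rewrite -map_cons map_inj_uniq ?up; last exact: perm_inj.
rewrite last_map lp eqxx !andbT path_map.
by rewrite (eq_path (e' := @adj G)) // => u v; exact: adj_tperm.
Qed.

Lemma dist_true_twins x y s : closed_nbhd x = closed_nbhd y ->
  s != x -> s != y -> dist s x = dist s y.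
Proof.
move=> e sx sy; apply: eq_find => k.
have fixs : tperm x y s = s by rewrite tpermD // eq_sym.
by apply/idP/idP => /(has_path_tperm e); rewrite fixs ?tpermL ?tpermR.
Qed.

Lemma resolving_closed_nbhd_inj S :
  resolving S -> {in ~: S &, injective (@closed_nbhd G)}.
Proof.
move=> /forallP RS x y; rewrite !inE => xS yS e.
apply/eqP/negPn/negP => xy.
have /implyP/(_ xy)/existsP[s /andP[sS]] := forallP (RS x) y.
case/eqP; apply: dist_true_twins => //.
  by apply: contraNneq xS => <-.
by apply: contraNneq yS => <-.
Qed.

Lemma resolving_card S : resolving S -> #|G| <= #|S| + #|closed_nbhds|.
Proof.
move=> /resolving_closed_nbhd_inj inj.
rewrite -(cardsC S) leq_add2l -(card_in_imset inj).
exact/subset_leq_card/imsetS/subset_predT.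
Qed.

(** * Comparison of the two dimensions *)

Lemma dist_eq1 x y : (dist x y == 1) = adj x y.
Proof.
have path1 : has_path_of_length x y 1 = adj x y.
  apply/existsP/idP => [[p]|xy].
    by case: (tupleP p) => z q; rewrite (tuple0 q) /= andbT => /and3P[? _ /eqP<-].
  exists [tuple y]; rewrite /= xy inE eqxx !andbT.
  by apply: contraTneq xy => ->; rewrite adj_irrefl.
have [<-|xy] := eqVneq x y.
  by rewrite adj_irrefl (eqP (_ : dist x x == 0)) ?dist_eq0.
(* Two distinct vertices put 1 in the range of [find], so a value 1 cannot be the dummy [#|G|]. *)
have : 1 < #|G| by rewrite -cardsT; apply/card_gt1P; exists x, y; rewrite !inE.
rewrite /dist; case: #|G| => [|[|n]] // _.
by rewrite /= has_path0 (negPf xy) path1; case: (adj x y).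
Qed.

(** As [x] and [y] differ, the cardinality is the sum of two adjacency bits. *)
Lemma card_open_nbhdI s x y : x != y ->
  (#|open_nbhd s :&: [set x; y]| == 1) = (adj s x (+) adj s y).
Proof.
move=> xy; rewrite setIC -sum1_card.
rewrite (eq_bigl (fun z => (z \in [set x; y]) && adj s z)); last first.
  by move=> z; rewrite !inE.
rewrite big_mkcondr big_setU1 ?inE //= big_set1.
by do 2!case: (adj s _).
Qed.

(** A vertex of [S] resolves itself from any other by distance 0. For a pair outside [S], adjacency
    means distance 1, so a vertex adjacent to exactly one of the two has different distances to
    them. *)
Lemma adjacency_resolving_resolving S : adjacency_resolving S -> resolving S.
Proof.
move=> /forallP AS; apply/forallP => x; apply/forallP => y; apply/implyP => xy.
have dist0 z : dist z z = 0 by apply/eqP; rewrite dist_eq0.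
have [xS|xS] := boolP (x \in S).
  by apply/existsP; exists x; rewrite xS dist0 eq_sym dist_eq0.
have [yS|yS] := boolP (y \in S).
  by apply/existsP; exists y; rewrite yS dist0 dist_eq0 eq_sym.
have /implyP := forallP (AS x) y; rewrite xy xS yS => /(_ isT).
case/existsP=> s /andP[sS]; rewrite card_open_nbhdI // => sxy.
apply/existsP; exists s; rewrite sS; apply: contraL sxy => /eqP.
by rewrite -!dist_eq1 => ->; rewrite addbb.
Qed.

Lemma metric_dimP : exists2 S : {set G}, resolving S & metric_dim G = #|S|.
Proof.
by rewrite /metric_dim; case: (arg_minnP _ (resolving_setT G)) => S; exists S.
Qed.

Lemma adjacency_dimP :
  exists2 S : {set G}, adjacency_resolving S & adjacency_dim G = #|S|.
Proof.
rewrite /adjacency_dim.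
by case: (arg_minnP _ (adjacency_resolving_setT G)) => S; exists S.
Qed.

Lemma metric_dim_le S : resolving S -> metric_dim G <= #|S|.
Proof.
by rewrite /metric_dim; case: (arg_minnP _ (resolving_setT G)) => T _; apply.
Qed.

Lemma adjacency_dim_le S : adjacency_resolving S -> adjacency_dim G <= #|S|.
Proof.
rewrite /adjacency_dim.
by case: (arg_minnP _ (adjacency_resolving_setT G)) => T _; apply.
Qed.

Lemma metric_dim_ge : #|G| <= metric_dim G + #|closed_nbhds|.
Proof. by have [S RS ->] := metric_dimP; exact: resolving_card. Qed.

Lemma metric_le_adjacency_dim : metric_dim G <= adjacency_dim G.
Proof.
have [S AS ->] := adjacency_dimP.
exact/metric_dim_le/adjacency_resolving_resolving.
Qed.

(** * Transversals and the upper bound *)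

Lemma closed_nbhd_transversal : exists A : {set G},
  {in A &, injective (@closed_nbhd G)} /\ @closed_nbhd G @: A = closed_nbhds.
Proof.
pose rep (B : {set G}) := [pick z : G | closed_nbhd z == B].
(* These are the vertices picked for their own neighbourhood; [rep] depends on the neighbourhood
   alone, hence injectivity. *)
exists [set x | rep (closed_nbhd x) == Some x]; split=> [x y|].
  by rewrite !inE => /eqP rx /eqP ry e; move: ry; rewrite -e rx => -[].
apply/eqP; rewrite eqEsubset imsetS ?subset_predT //=.
apply/subsetP => _ /imsetP[x _ ->].
have : exists2 z, closed_nbhd z = closed_nbhd x & rep (closed_nbhd x) = Some z.
  rewrite /rep; case: pickP => [z /eqP zx|/(_ x)]; first by exists z.
  by rewrite /= eqxx.
by case=> z zx Ez; apply/imsetP; exists z; rewrite // inE zx Ez.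
Qed.

Lemma adjacency_dim_true_twins : nontrivial_class = [set: G] ->
  adjacency_dim G + #|closed_nbhds| <= #|G|.
Proof.
move=> /setP twins; have [A [injA imA]] := closed_nbhd_transversal.
rewrite -imA (card_in_imset injA) -(cardsC A) addnC leq_add2l.
apply: adjacency_dim_le.
(* Any z separating two closed neighbourhoods can be traded for a twin outside A. *)
have rep z : exists2 s, s \in ~: A & closed_nbhd s = closed_nbhd z.
  have [zA|zA] := boolP (z \in A); last by exists z; rewrite ?inE.
  have := twins z; rewrite !inE => /existsP[s /andP[sz /eqP e]].
  exists s; last by [].
  by rewrite inE; apply: contra_neqN sz => sA; exact: injA.
apply/forallP => x; apply/forallP => y; apply/implyP => /and3P[xy xS yS].
have [z zxy] : exists z, (z \in closed_nbhd x) (+) (z \in closed_nbhd y).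
  apply/existsP; apply: contra_neqT xy => /existsPn e.
  move: xS yS; rewrite !inE !negbK => xA yA; apply: injA => //.
  by apply/setP => z; have := e z; do 2!case: (z \in _).
have [s sS e] := rep z; apply/existsP; exists s.
rewrite sS card_open_nbhdI // !adj_closed_nbhd !(in_closed_nbhdC _ s).
rewrite !(closed_nbhd_eq_mem _ e).
(* [s] lies outside [A] while [x] and [y] lie in it, so open and closed adjacency to [s] agree on
   them. *)
have /negPf-> : x != s by apply: contraNneq xS => ->.
by have /negPf-> : y != s by apply: contraNneq yS => ->.
Qed.

(** * Counting closed neighbourhoods by true twin classes *)

Definition true_class (B : {set G}) : {set G} := [set y | closed_nbhd y == B].

Lemma true_class_inj : {in closed_nbhds &, injective true_class}.
Proof.
move=> _ _ /imsetP[x _ ->] /imsetP[y _ ->] /setP/(_ x).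
by rewrite !inE eqxx => /esym/eqP.
Qed.

(** True and false twins do not mix: if [z] had the open neighbourhood of [x], it would be adjacent
    to [y], hence equal or adjacent to [x]; adjacency would make [z] its own neighbour. *)
Lemma twin_true_twin x y z : y != x -> closed_nbhd y = closed_nbhd x ->
  twin x z -> closed_nbhd z = closed_nbhd x.
Proof.
move=> yx e /orP[/eqP //|/eqP/setP o].
have xy : adj x y by rewrite adj_closed_nbhd yx -e mem_closed_nbhd.
have zy : z \in closed_nbhd x.
  by rewrite -e in_closed_nbhdC; have := o y; rewrite !inE xy => <-; rewrite orbT.
by have := o z; move: zy; rewrite !inE adj_irrefl => /orP[/eqP->|->].
Qed.

Lemma true_twin_classesE : true_twin_classes G =
  [set true_class (closed_nbhd x) | x in nontrivial_class].
Proof.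
apply/setP => U; rewrite inE; apply/idP/imsetP.
  case/andP=> /imsetP[x _ ->] /andP[/card_gt1P[a [b [aU bU ab]]] /forall_inP tU].
  have xU : x \in [set y in [set: G] | twin x y] by rewrite !inE /twin !eqxx.
  have cU y : y \in [set y in [set: G] | twin x y] ->
      closed_nbhd y = closed_nbhd x.
    by move=> yU; apply/eqP/(forall_inP (tU y yU)).
  exists x.
    (* Of two distinct members [a] and [b], at least one differs from the representative [x]. *)
    rewrite inE; have [ax|ax] := eqVneq a x; apply/existsP.
      by exists b; rewrite -{1}ax eq_sym ab (cU b bU) eqxx.
    by exists a; rewrite ax (cU a aU) eqxx.
  apply/setP => y; rewrite [RHS]inE; apply/idP/eqP => [/cU //|e].
  by rewrite !inE /twin e eqxx.
case=> x; rewrite inE => /existsP[y /andP[yx /eqP e]] ->.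
apply/and3P; split.
- apply/imsetP; exists x => //; apply/setP => z; rewrite !inE /=.
  apply/eqP/idP => [ez|/(twin_true_twin yx e) //].
  by rewrite /twin ez eqxx.
- by apply/card_gt1P; exists y, x; rewrite !inE e eqxx.
- apply/forall_inP => a; rewrite inE => /eqP->.
  by apply/forall_inP => b; rewrite inE => /eqP->.
Qed.

Lemma cover_true_twin_classes : cover (true_twin_classes G) = nontrivial_class.
Proof.
rewrite true_twin_classesE /cover; apply/setP => x; apply/bigcupP/idP.
  case=> _ /imsetP[z zD ->]; rewrite inE => /eqP e.
  have [->//|xz] := eqVneq x z.
  by rewrite inE; apply/existsP; exists z; rewrite eq_sym xz e eqxx.
move=> xD; exists (true_class (closed_nbhd x)); last by rewrite inE.
exact: imset_f.
Qed.

(** Over vertices with a true twin, closed neighbourhoods correspond to classes by [true_class];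
    over the others, [closed_nbhd] is injective. No neighbourhood occurs on both sides, since
    sharing one makes a true twin. *)
Lemma card_closed_nbhds :
  #|closed_nbhds| =
  #|true_twin_classes G| + #|~: cover (true_twin_classes G)|.
Proof.
rewrite cover_true_twin_classes true_twin_classesE; set D := nontrivial_class.
have injC : {in ~: D &, injective (@closed_nbhd G)}.
  move=> x y; rewrite !inE => /existsPn/(_ y) + _ e.
  by rewrite e eqxx andbT negbK => /eqP.
have injT : {in @closed_nbhd G @: D &, injective true_class}.
  have sub (B : {set G}) : B \in @closed_nbhd G @: D -> B \in closed_nbhds.
    exact/subsetP/imsetS/subset_predT.
  by move=> B C /sub BD /sub CD; exact: true_class_inj.
rewrite (imset_comp true_class (@closed_nbhd G)) (card_in_imset injT).
rewrite -(card_in_imset injC).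
have -> : closed_nbhds = @closed_nbhd G @: D :|: @closed_nbhd G @: (~: D).
  rewrite -imsetU setUCr; apply/setP => B.
  by apply/imsetP/imsetP => -[x _ ->]; exists x; rewrite ?inE.
(* The union bound is an equality exactly when the two sets are disjoint. *)
apply/eqP; rewrite (leq_card_setU _ _).2 disjoints_subset.
apply/subsetP => _ /imsetP[x xD ->]; rewrite inE.
apply/imsetP => -[y]; rewrite inE => yD e; case/negP: yD.
have [<-//|xy] := eqVneq x y.
by rewrite inE; apply/existsP; exists x; rewrite xy e eqxx.
Qed.

End TrueTwins.

(** * Closed neighbourhoods in the strong product *)

Section StrongProductNeighbourhoods.
Variables G H : sgraph.
Let K := strong_product G H.

Lemma closed_nbhd_strong (x : K) :
  closed_nbhd x = setX (closed_nbhd x.1) (closed_nbhd x.2).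
Proof.
case: x => a b; apply/setP => -[u v]; rewrite in_closed_nbhdC in_setX.
rewrite in_setU1 [_ \in open_nbhd _]inE /= /strong_adj eq_sym.
by have [[-> ->]|] := eqVneq (u, v) (a, b); rewrite ?mem_closed_nbhd.
Qed.

Lemma card_closed_nbhds_strong :
  #|closed_nbhds K| = #|closed_nbhds G| * #|closed_nbhds H|.
Proof.
pose prod (p : {set G} * {set H}) : {set G * H} := setX p.1 p.2.
have -> : closed_nbhds K = prod @: setX (closed_nbhds G) (closed_nbhds H).
  apply/setP => B; apply/imsetP/imsetP => [[x _ ->]|[[A1 A2]]].
    exists (closed_nbhd x.1, closed_nbhd x.2); last exact: closed_nbhd_strong.
    by rewrite in_setX !imset_f.
  rewrite in_setX => /andP[/imsetP[/= x _ ->] /imsetP[/= y _ ->]] ->.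
  by exists (x, y); rewrite ?closed_nbhd_strong.
rewrite card_in_imset ?cardsX // => -[A1 A2] [B1 B2].
rewrite !in_setX => /andP[/= /imsetP[a _ ->] /imsetP[b _ ->]].
move=> /andP[/imsetP[c _ ->] /imsetP[d _ ->]] /setP /= e.
have eq_pair u v := e (u, v).
(* A nonempty product determines its factors: [(a, b)] lies in both products, and slicing through it
   recovers each factor. *)
have [ac bd] : a \in closed_nbhd c /\ b \in closed_nbhd d.
  by have := eq_pair a b; rewrite !inE /= !eqxx /= => /esym/andP.
congr pair; apply/setP => u.
  by have := eq_pair u b; rewrite !in_setX /= mem_closed_nbhd bd !andbT.
by have := eq_pair a u; rewrite !in_setX /= mem_closed_nbhd ac.
Qed.

Lemma nontrivial_class_strong :
  nontrivial_class G = [set: G] -> nontrivial_class K = [set: K].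
Proof.
move=> /setP twins; apply/setP => -[x y]; rewrite [RHS]inE inE.
have := twins x; rewrite !inE => /existsP[z /andP[zx /eqP e]].
apply/existsP; exists ((z, y) : K); rewrite !closed_nbhd_strong /= e eqxx andbT.
by rewrite xpair_eqE negb_and zx.
Qed.

End StrongProductNeighbourhoods.

Theorem theorem31 (G H : sgraph) (n n' t t' n1 n1' : nat)
  (connG : connected G) (connH : connected H)
  (orderG : #|G| = n) (orderH : #|H| = n')
  (ttcG : #|true_twin_classes G| = t) (ttcH : #|true_twin_classes H| = t')
  (restG : #|~: cover (true_twin_classes G)| = n1)
  (restH : #|~: cover (true_twin_classes H)| = n1') :
  ((n%:Z * n'%:Z - n1%:Z * t'%:Z - n1'%:Z * t%:Z - t%:Z * t'%:Z
      - n1%:Z * n1'%:Z <= (metric_dim (strong_product G H))%:Z)%R) /\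
  (partition (true_twin_classes G) [set: G] ->
     adjacency_dim (strong_product G H) = metric_dim (strong_product G H) /\
     ((metric_dim (strong_product G H))%:Z
        = n%:Z * n'%:Z - n1'%:Z * t%:Z - t%:Z * t'%:Z)%R).
Proof.
have cG := card_closed_nbhds G; have cH := card_closed_nbhds H.
have lower := metric_dim_ge (strong_product G H).
have cardK : #|strong_product G H| = n * n' by rewrite card_prod orderG orderH.
rewrite card_closed_nbhds_strong cG cH ttcG ttcH restG restH cardK in lower.
(* Expanding [(t + n1) * (t' + n1')] gives the four subtracted products. *)
split=> [|/cover_partition covG]; first by nia.
have n1_0 : n1 = 0 by rewrite -restG covG setCT cards0.
rewrite cover_true_twin_classes in covG.
have upper := adjacency_dim_true_twins (nontrivial_class_strong H covG).
rewrite card_closed_nbhds_strong cG cH ttcG ttcH restG restH cardK in upper.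
have le := metric_le_adjacency_dim (strong_product G H).
(* With [n1 = 0], both dimensions are squeezed: [lower], [le] and [upper] start and end at
   [n * n' - t * (t' + n1')]. *)
by split; nia.
Qed.
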